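(* For every integer $n\ge 4$, consider the configuration on $\mathbb{Z}^2$ with $n$ particles at the origin $(0,0)$ and exactly $2$ particles in every other cell, and let $\mathcal{T}_n$ be the toppled cluster of its stabilisation in the abelian sandpile model (the stabilisation terminates). Then $\mathcal{T}_n$ is a square centred at the origin, i.e. $\mathcal{T}_n=\{(x,y)\in\mathbb{Z}^2:\max(|x|,|y|)\le r_n-1\}$ for some integer $r_n\ge 1$ (the radius of $\mathcal{T}_n$), and $$r_n\le 4(1+o(1))\sqrt{n}\qquad\text{as } n\to\infty,$$ that is, there is a function $\varepsilon(n)$ with $\varepsilon(n)\to 0$ as $n\to\infty$ such that $r_n\le 4(1+\varepsilon(n))\sqrt{n}$ for all $n\ge 4$.
   Context: Abelian sandpile model on $\mathbb{Z}^2$: elements of $\mathbb{Z}^2$ are called cells. A configuration assigns an integer (number of particles) to each cell. A cell is active if it contains at least $4$ particles and stable otherwise. An active cell $(x,y)$ may be toppled: $4$ particles are removed from $(x,y)$ and one particle is added to each of its four neighbours $(x\pm1,y)$, $(x,y\pm1)$. Stabilisation is the procedure of successively toppling active cells, in any chosen order, until every cell is stable. It terminates if this state is reached after finitely many topplings. By the standard abelian property, if the stabilisation terminates for some order of topplings, it terminates for any order, and the cells toppled (with multiplicity) and the final configuration do not depend on the order. The toppled cluster is the set of cells toppled at least once during the stabilisation. The radius of a set $\mathscr{C}\subseteq\mathbb{Z}^2$ of cells is $\sup_{(x,y)\in\mathscr{C}}\max(|x|,|y|)+1$ if $\mathscr{C}$ is non-empty, and $0$ if $\mathscr{C}$ is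 empty. *)

(* Defs.v *)
From HB Require Import structures.
From mathcomp Require Import all_boot all_order all_algebra.
From mathcomp Require Import zify.
From mathcomp Require Import boolp classical_sets reals ereal.
From mathcomp Require Import topology normedtype sequences.

Set Implicit Arguments.
Unset Strict Implicit.
Unset Printing Implicit Defensive.

Import Order.TTheory GRing.Theory Num.Theory.
Import numFieldNormedType.Exports.

Local Open Scope classical_set_scope.
Local Open Scope ring_scope.

Definition cell := (int * int)%type.

Definition config := cell -> int.

Definition neighbours (z : cell) : seq cell :=
  [:: (z.1 + 1, z.2); (z.1 - 1, z.2); (z.1, z.2 + 1); (z.1, z.2 - 1)].

Definition active (c : config) (z : cell) : bool := 4 <= c z.

Definition stable (c : config) : Prop := forall z, ~~ active c z.

Definition topple (c : config) (z : cell) : config :=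
  fun w => if w == z then c w - 4
           else if w \in neighbours z then c w + 1 else c w.

Definition topples (c : config) (s : seq cell) : config := foldl topple c s.

(* Each cell of [s], taken from left to right, is active when it is toppled. *)
Fixpoint legal (c : config) (s : seq cell) : bool :=
  if s is z :: s' then active c z && legal (topple c z) s' else true.

Definition stabilises (c : config) (s : seq cell) : Prop :=
  legal c s /\ stable (topples c s).

Definition stabilisation_terminates (c : config) : Prop :=
  exists s, stabilises c s.

(* The order of the topplings is existentially quantified; by [abelian_property]
   all orders give the same cluster. *)
Definition toppled_cluster (c : config) : set cell :=
  [set z | exists2 s, stabilises c s & z \in s].

Definition cell_norm (z : cell) : int := Num.max `|z.1| `|z.2|.

(* Extended-real valued, so that unbounded sets have radius [+oo]; the empty
   set is singled out because the [ereal_sup] of the empty set is [-oo]. *)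
Definition cell_radius (R : realType) (C : set cell) : \bar R :=
  if `[< C = set0 >] then 0%E
  else (ereal_sup [set ((cell_norm z)%:~R : R)%:E | z in C] + 1)%E.

Arguments cell_radius R C : clear implicits.

Definition centred_square (r : int) : set cell :=
  [set z | cell_norm z <= r - 1].

Definition pile (n : nat) : config := fun z => if z == (0, 0) then n%:Z else 2.

Lemma topplesE c s w :
  topples c s w = c w - 4 * (count_mem w s)%:Z
    + \sum_(v <- neighbours w) (count_mem v s)%:Z.
Proof.
case: w => x y.
elim: s c => [|z s IH] c; first by rewrite /= !big_cons big_nil; lia.
rewrite /= IH /topple /neighbours !big_cons !big_nil /= !inE.
case: z => [a b] /=; rewrite !xpair_eqE /=.
by do ![case: eqP => ? /=]; lia.
Qed.

Lemma legal_rcons c s z :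
  legal c (rcons s z) = legal c s && active (topples c s) z.
Proof. by elim: s c => [|y s IH] c /=; rewrite ?andbT // IH andbA. Qed.

Lemma least_action c s t : legal c s -> stable (topples c t) ->
  forall z, (count_mem z s <= count_mem z t)%N.
Proof.
move=> + st; elim/last_ind: s => [|s z IH]; first by [].
rewrite legal_rcons => /andP[/IH le_st act_z] w.
rewrite -cats1 count_cat /= addn0; have := le_st w.
case: eqP => [zw|_]; last by rewrite addn0.
subst w; move=> le_z; have := st z; move: act_z; rewrite /active !topplesE.
have : \sum_(v <- neighbours z) (count_mem v s)%:Z
    <= \sum_(v <- neighbours z) (count_mem v t)%:Z
  by apply: ler_sum => v _; rewrite lez_nat; apply: le_st.
move: le_z.
generalize (\sum_(v <- neighbours z) (count_mem v s)%:Z).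
generalize (\sum_(v <- neighbours z) (count_mem v t)%:Z).
move: (count_mem z s) (count_mem z t) => a b; lia.
Qed.

Theorem abelian_property c s t : stabilises c s -> stabilises c t ->
  perm_eq s t /\ topples c s = topples c t.
Proof.
move=> [ls ss] [lt tt].
have E z : count_mem z s = count_mem z t.
  by apply/eqP; rewrite eqn_leq (least_action ls tt) (least_action lt ss).
split; first by apply/allP => z _; rewrite /= E.
apply/funext => w; rewrite !topplesE E; congr (_ + _).
by apply: eq_bigr => v _; rewrite E.
Qed.

Theorem terminates_any_order c s t : legal c s -> stabilises c t ->
  (size s <= size t)%N.
Proof.
move=> ls [_ tt]; have le := least_action ls tt.
elim: s t le {ls tt} => [|z s IH] t le //=.
have zt : z \in t by rewrite -has_pred1 has_count; have := le z; rewrite /= eqxx; lia.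
have /permP p := perm_to_rem zt.
have -> : size t = (size (rem z t)).+1 by rewrite (perm_size (perm_to_rem zt)).
rewrite ltnS; apply: IH => w; have := le w; rewrite p /=; lia.
Qed.

Lemma toppled_clusterE c s : stabilises c s -> toppled_cluster c = [set` s].
Proof.
move=> hs; apply/seteqP; split=> z /=; last by exists s.
by case=> t /(abelian_property hs)[/perm_mem-> _].
Qed.

(* Main.v *)
Require Import Defs.
From HB Require Import structures.
From mathcomp Require Import all_boot all_order all_algebra.
From mathcomp Require Import boolp classical_sets reals ereal.
From mathcomp Require Import topology normedtype sequences.
From mathcomp Require Import exp zify ring lra.

Set Implicit Arguments.
Unset Strict Implicit.
Unset Printing Implicit Defensive.

Import Order.TTheory GRing.Theory Num.Theory.
Import numFieldNormedType.Exports.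

Local Open Scope classical_set_scope.
Local Open Scope ring_scope.

(** Two independent arguments carry the proof; both use that an odometer (the
    function counting the topplings at each cell) [w] changes a configuration
    by its discrete Laplacian.

    Shape ([toppled_square]).  The cluster is invariant under the symmetries of
    the grid, because the stabilisation is unique.  A cell other than the
    origin starts with 2 particles, so it topples as soon as two of its
    neighbours do.  If a square has toppled and something outside topples, then
    the first such cell is adjacent to the square; the toppling spreads from it
    along that side of the frame around the square, since every cell of a side
    already has one toppled neighbour in the square; by symmetry it reaches the
    four sides, and then the corners.  So the cluster is exhausted by squares.

    Size ([exists_small_cluster]).  By the least action principle it is enough to
    exhibit a finitely supported integer function [w >= 0] whose Laplacian is at
    most [1] off the origin and at most [3 - n] at the origin: then the
    stabilisation terminates and topples only cells of the support
    ([odometer_bound]).  Let [k] be the sup norm of a cell.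

    Far from the origin take the pyramid [g = (m - k + 1)(m - k) / 2]: its
    Laplacian is at most [1], thanks to a concave ridge on the diagonals, but its
    tip only absorbs [4 m] particles.  Near the origin take instead the spike
    [f], the ceiling of [C - q ln (x^2 + y^2 + 1/2) - (x^2 + y^2) / 2] with
    [q = n / (4 ln 3)].  The logarithm here is exactly subharmonic, with
    Laplacian [4 ln 3] at the origin; the quadratic term lowers the Laplacian by
    [2], and taking the ceiling raises it by less than [4].  So the Laplacian
    of [f] is at most [1], and at most [1 - n] at the origin.

    The two functions are glued by taking their minimum in the annulus
    [j < k < 3 j], with [m = 9 j].  A minimum inherits upper bounds on the
    Laplacian, and the gluing is seamless if [f <= g] for [k = j] and [g <= f] for
    [k = 3 j] ([laplacian_glue_le]).  The constant [C] makes the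
    second inequality an equality, before rounding, at the corners of the square
    of norm [3 j].
    Since [(18 j^2 + 1/2) / (j^2 + 1/2) <= 27 = 3^3], the logarithm costs at most
    [3 n / 4] between the two squares, while the spike otherwise has a margin of
    [11 j^2 / 2 + j], so [3 n <= 22 j^2] suffices.  The radius is then at most
    [9 j], and with [j] just above [4 sqrt n / 9] this is at most
    [4 sqrt n + 9]. *)

(** * Sup norm and discrete Laplacian *)

Definition supnorm (z : cell) : nat := maxn `|z.1|%N `|z.2|%N.

Lemma cell_normE z : cell_norm z = (supnorm z)%:Z.
Proof. by rewrite /cell_norm /supnorm; case: z => x y /=; lia. Qed.

Lemma supnorm_eq0 z : (supnorm z == 0%N) = (z == (0, 0)).
Proof. by case: z => x y; rewrite xpair_eqE /supnorm /=; lia. Qed.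

Lemma supnorm_neighbour z v :
  v \in neighbours z -> (supnorm v <= (supnorm z).+1)%N /\ (supnorm z <= (supnorm v).+1)%N.
Proof.
case: z => x y; rewrite /neighbours !inE /supnorm /=.
by do ![case/orP]=> /eqP-> /=; lia.
Qed.

Definition laplacian (V : pzRingType) (f : cell -> V) (z : cell) : V :=
  \sum_(v <- neighbours z) f v - 4 * f z.

Lemma laplacianE (V : pzRingType) (f : cell -> V) x y :
  laplacian f (x, y) =
    f (x + 1, y) + f (x - 1, y) + f (x, y + 1) + f (x, y - 1) - 4 * f (x, y).
Proof. by rewrite /laplacian /neighbours !big_cons big_nil addr0 !addrA. Qed.

Lemma topples_laplacian c s z :
  topples c s z = c z + laplacian (fun v => (count_mem v s)%:Z) z.
Proof. by rewrite topplesE /laplacian addrAC addrA. Qed.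

Lemma le_laplacian (f g : cell -> int) z :
  (forall v, v \in neighbours z -> f v <= g v) -> f z = g z ->
  laplacian f z <= laplacian g z.
Proof.
move=> le_fg fz; rewrite /laplacian fz lerD2r !big_seq.
by apply: ler_sum => v /le_fg.
Qed.

(** * Termination and the least action principle *)

Lemma exists_count_mem (w : cell -> nat) (B : seq cell) : uniq B ->
  exists t, forall z, count_mem z t = if z \in B then w z else 0%N.
Proof.
elim: B => [_|b B IH] /=; first by exists [::].
case/andP=> bB /IH[t ht]; exists (nseq (w b) b ++ t) => z.
rewrite count_cat count_nseq ht in_cons (eq_sym z) /=.
by case: (b =P z) => [<-|_] /=; rewrite ?(negbTE bB) ?mul1n ?addn0 ?mul0n.
Qed.

Lemma exists_topplings (w : cell -> nat) m :
  (forall z, (m <= supnorm z)%N -> w z = 0%N) ->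
  exists t, forall z, count_mem z t = w z.
Proof.
move=> w0.
pose rg : seq int := [seq i%:Z - m%:Z | i <- iota 0 (m + m)].
have mem_rg (x : int) : (`|x| < m)%N -> x \in rg.
  move=> xm; apply/mapP; exists (absz (x + m%:Z)); last by lia.
  by rewrite mem_iota; lia.
have [t ht] := exists_count_mem w (undup_uniq [seq (x, y) | x <- rg, y <- rg]).
exists t => z; rewrite ht mem_undup; case: ifP => // /negP zB.
case: leqP (w0 z) => [_ ->//|zm _]; case: zB; case: z zm => x y.
rewrite /supnorm gtn_max => /andP[/= xm ym].
by apply/allpairsP; exists (x, y); rewrite !mem_rg.
Qed.

Lemma legal_size_le c s t :
  legal c s -> stable (topples c t) -> (size s <= size t)%N.
Proof.
move=> ls st; have := least_action ls st.
elim: s t {ls st} => [//|z s IH] t le.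
have zt : z \in t by rewrite -has_pred1 has_count; have := le z; rewrite /= eqxx; lia.
have /permP p := perm_to_rem zt.
rewrite (perm_size (perm_to_rem zt)) /= ltnS; apply: IH => w.
by have := le w; rewrite p /=; lia.
Qed.

(** A legal sequence that cannot be prolonged stabilises; the lengths of
    legal sequences are bounded by that of any, possibly illegal, sequence with
    a stable outcome. *)
Lemma terminates_of_stable c t :
  stable (topples c t) -> stabilisation_terminates c.
Proof.
move=> st; apply: contrapT => nt.
suff /(_ (size t).+1)[s [ls sz]] : forall k, exists s, legal c s /\ size s = k.
  by have := legal_size_le ls st; rewrite sz ltnn.
elim=> [|k [s [ls sz]]]; first by exists [::].
have /existsNP[z /negP] : ~ stable (topples c s) by move=> ss; apply: nt; exists s.
rewrite negbK => az; exists (rcons s z).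
by rewrite legal_rcons ls az size_rcons sz.
Qed.

(** The topplings prescribed by [w] need not be legal in any order: the least action
    principle only asks that their outcome be stable. *)
Lemma odometer_bound c (w : cell -> int) m :
  (forall z, 0 <= w z) -> (forall z, (m <= supnorm z)%N -> w z = 0) ->
  (forall z, laplacian w z <= 3 - c z) ->
  exists2 s, stabilises c s & forall z, z \in s -> (supnorm z < m)%N.
Proof.
move=> w_ge0 w0 lap_w.
have [t ht] : exists t, forall z, count_mem z t = `|w z|%N.
  by apply: (exists_topplings (m := m)) => z /w0->.
have st : stable (topples c t).
  move=> z; rewrite /active topples_laplacian.
  have -> : (fun v => (count_mem v t)%:Z) = w.
    by apply/funext => v; rewrite ht gez0_abs.
  by have := lap_w z; lia.
have [s [ls ss]] := terminates_of_stable st.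
exists s => // z zs; rewrite ltnNge; apply/negP => /w0 wz.
have := least_action ls st z; rewrite ht wz leqn0.
by apply/negP; rewrite -lt0n -has_count has_pred1.
Qed.

(** * The toppled cluster is a square *)

(** A symmetry of the grid preserving the configuration maps a stabilising sequence to
    another one, and all stabilising sequences topple the same cells. *)
Lemma mem_toppled_image c s (f : cell -> cell) : involutive f ->
  (forall z, c (f z) = c z) ->
  (forall z v, (f v \in neighbours (f z)) = (v \in neighbours z)) ->
  stabilises c s -> forall z, (f z \in s) = (z \in s).
Proof.
move=> fK cf nf st; have f_inj := inv_inj fK.
have topple_img (d e : config) z : (forall w, d (f w) = e w) ->
    forall w, topple d (f z) (f w) = topple e z w.
  by move=> de w; rewrite /topple (inj_eq f_inj) nf de.
have img (d e : config) u : (forall w, d (f w) = e w) ->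
    legal d (map f u) = legal e u /\
    forall w, topples d (map f u) (f w) = topples e u w.
  elim: u d e => [//|z u IH] d e de /=.
  have [-> tE] := IH _ _ (topple_img d e z de).
  by rewrite /active de.
have [lE tE] := img c c s cf.
have stf : stabilises c (map f s).
  case: st => ls ss; split; first by rewrite lE.
  by move=> z; rewrite /active -(fK z) tE; apply: ss.
have [/perm_mem E _] := abelian_property st stf.
by move=> z; rewrite E mem_map.
Qed.

Lemma mem_toppled_swap n s x y :
  stabilises (pile n) s -> ((y, x) \in s) = ((x, y) \in s).
Proof.
move=> st; apply: (mem_toppled_image (f := fun z => (z.2, z.1)) _ _ _ st (x, y)).
- by case.
- by case=> a b; rewrite /pile !xpair_eqE andbC.
- by case=> a b [a' b']; rewrite /neighbours !inE !xpair_eqE /=; lia.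
Qed.

Lemma mem_toppled_opp n s x y :
  stabilises (pile n) s -> ((- x, y) \in s) = ((x, y) \in s).
Proof.
move=> st; apply: (mem_toppled_image (f := fun z => (- z.1, z.2)) _ _ _ st (x, y)).
- by case=> a b /=; rewrite opprK.
- by case=> a b; rewrite /pile !xpair_eqE oppr_eq0.
- by case=> a b [a' b']; rewrite /neighbours !inE !xpair_eqE /=; lia.
Qed.

Lemma legal_cat c p q : legal c (p ++ q) = legal c p && legal (topples c p) q.
Proof. by elim: p c => //= z p IH c; rewrite IH andbA. Qed.

Section Square.

Variables (n : nat) (s : seq cell).
Hypotheses (n_ge4 : (4 <= n)%N) (st : stabilises (pile n) s).

Let S x y := (x, y) \in s.

Let S_swap x y : S y x = S x y. Proof. exact: mem_toppled_swap st. Qed.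
Let S_oppl x y : S (- x) y = S x y. Proof. exact: mem_toppled_opp st. Qed.
Let S_oppr x y : S x (- y) = S x y. Proof. by rewrite S_swap S_oppl S_swap. Qed.
Let S_absl x y : S `|x| y = S x y. Proof. by case: (ger0P x); rewrite ?S_oppl. Qed.
Let S_absr x y : S x `|y| = S x y. Proof. by rewrite S_swap S_absl S_swap. Qed.

Lemma mem_toppled_origin : (0, 0) \in s.
Proof.
apply/negPn/negP => n0; have := st.2 (0, 0).
rewrite /active topples_laplacian laplacianE /pile eqxx.
have -> : count_mem (0, 0) s = 0%N by apply/count_memPn.
lia.
Qed.

(** An untoppled cell other than the origin starts with two particles and stays
    stable, so it receives at most one. *)
Lemma mem_toppled_of_two_neighbours z u v : z != (0, 0) -> uniq [:: u; v] ->
  u \in neighbours z -> v \in neighbours z -> u \in s -> v \in s -> z \in s.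
Proof.
move=> z0 uv uz vz us vs; apply/negPn/negP => zs; have := st.2 z.
rewrite /active topples_laplacian /laplacian /pile (negbTE z0).
rewrite (count_memPn zs) mulr0 subr0.
have c_gt0 w : w \in s -> (0 < count_mem w s)%N by rewrite -has_count has_pred1.
move: (c_gt0 _ us) (c_gt0 _ vs) uv uz vz.
case: z {z0 zs} => a b; rewrite /neighbours !big_cons big_nil /= !inE.
move=> cu cv; rewrite andbT => uv.
by do ![case/orP]=> /eqP Eu; do ![case/orP]=> /eqP Ev; subst u v;
   move: cu cv uv; rewrite ?eqxx //; lia.
Qed.

(** The first cell toppled outside a square has at that time received particles
    from the square only, hence it is adjacent to it. *)
Lemma first_toppled_outside (k : nat) : has (fun z => (k < supnorm z)%N) s ->
  exists2 z, z \in s &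
    supnorm z = k.+1 /\ exists2 v, v \in neighbours z & (supnorm v <= k)%N.
Proof.
move=> hk; have [+ _] := st; case: (split_find hk) => z p q kz /hasPn pk.
rewrite legal_cat legal_rcons => /andP[/andP[_]].
have z0 : z != (0, 0) by rewrite -supnorm_eq0; lia.
rewrite /active topples_laplacian /laplacian /pile (negbTE z0) => az _.
have [v vz vp] : exists2 v, v \in neighbours z & v \in p.
  apply/hasP; apply: contraT => /hasPn np; move: az.
  rewrite big_seq big1 => [|v /np/count_memPn-> //]; lia.
have vk : (supnorm v <= k)%N by rewrite leqNgt pk.
exists z; first by rewrite mem_cat mem_rcons mem_head.
split; last by exists v.
by have [_] := supnorm_neighbour vz; lia.
Qed.

Let square_sub (k : nat) := forall z, (supnorm z <= k)%N -> z \in s.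

(** Every cell of a side of the frame around a toppled square receives a particle
    from the square, and a second one as soon as a cell next to it in that side
    topples. *)
Lemma toppled_side (k : nat) y0 y : square_sub k ->
  (`|y0| <= k)%N -> (`|y| <= k)%N -> S k.+1%:Z y0 -> S k.+1%:Z y.
Proof.
move=> sq.
have up y1 y2 : (`|y1| <= k)%N -> y1 <= y2 -> y2 <= k%:Z ->
    S k.+1%:Z y1 -> S k.+1%:Z y2.
  move=> y1k y12; have -> : y2 = y1 + (absz (y2 - y1))%:Z by lia.
  elim: (absz _) => [|d IH] dk S1; first by rewrite addr0.
  have {}IH := IH ltac:(lia) S1.
  apply: (@mem_toppled_of_two_neighbours (k.+1%:Z, y1 + d.+1%:Z)
    (k.+1%:Z, y1 + d%:Z) (k%:Z, y1 + d.+1%:Z)) => //.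
  - by rewrite /= inE xpair_eqE; lia.
  - by rewrite /neighbours !inE !xpair_eqE /=; lia.
  - by rewrite /neighbours !inE !xpair_eqE /=; lia.
  - by apply: sq; rewrite /supnorm /=; lia.
(* Going up from [y0] to the corner, then reflecting, gives the lowest cell of
   the side, from which the whole side is reached upwards. *)
move=> y0k yk S0; apply: (up (- k%:Z)); [lia|lia|lia|].
by rewrite S_oppr; apply: up S0; lia.
Qed.

Lemma square_sub_succ (k : nat) :
  square_sub k -> has (fun z => (k < supnorm z)%N) s -> square_sub k.+1.
Proof.
move=> sq /first_toppled_outside[[x y] xys [zk [[x' y'] vz vk]]].
have [y0 y0k S0] : exists2 y0, (`|y0| <= k)%N & S k.+1%:Z y0.
  have {vz vk} : (`|y| <= k)%N && (`|x| == k.+1) || (`|x| <= k)%N && (`|y| == k.+1).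
    move: vz vk zk; rewrite /neighbours !inE !xpair_eqE /supnorm /=; lia.
  case/orP => /andP[? ?]; [exists y|exists x] => //; move: xys; rewrite -/(S x y).
    by rewrite -S_absl; have -> : `|x| = k.+1%:Z by lia.
  by rewrite -S_absr S_swap; have -> : `|y| = k.+1%:Z by lia.
have side b : (`|b| <= k)%N -> S k.+1%:Z b.
  by move=> bk; apply: toppled_side sq y0k bk S0.
(* A corner is next to the ends of two sides. *)
have corner : S k.+1%:Z k.+1%:Z.
  apply: (@mem_toppled_of_two_neighbours _ (k.+1%:Z, k%:Z) (k%:Z, k.+1%:Z)).
  - by [].
  - by rewrite /= inE xpair_eqE; lia.
  - by rewrite /neighbours !inE !xpair_eqE /=; lia.
  - by rewrite /neighbours !inE !xpair_eqE /=; lia.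
  - by apply: side.
  - by rewrite -/(S _ _) S_swap; apply: side.
case=> a b abk; rewrite -/(S a b).
rewrite -S_absl -S_absr; move: abk; rewrite /supnorm /= => abk.
have [ak|ak] := leqP `|a|%N k; have [bk|bk] := leqP `|b|%N k.
- by apply: sq; rewrite /supnorm /=; lia.
- have -> : `|b| = k.+1%:Z by lia.
  by rewrite S_swap; apply: side; lia.
- have -> : `|a| = k.+1%:Z by lia.
  by apply: side; lia.
- have -> : `|a| = k.+1%:Z by lia.
  by have -> : `|b| = k.+1%:Z by lia.
Qed.

(** Otherwise the squares of all sizes topple, against the finiteness of [s]. *)
Lemma toppled_square : exists k : nat, forall z, (z \in s) = (supnorm z <= k)%N.
Proof.
apply: contrapT => no_sq.
have sq k : square_sub k.
  elim: k => [z|k IH].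
    by rewrite leqn0 supnorm_eq0 => /eqP->; apply: mem_toppled_origin.
  apply: square_sub_succ => //; apply: contraT => /hasPn out.
  case: no_sq; exists k => z; apply/idP/idP; last exact: IH.
  by move/out; rewrite -leqNgt.
pose M := (\max_(z <- s) supnorm z).+1.
have normM : supnorm (M%:Z, 0%:Z) = M by rewrite /supnorm /= maxn0.
have : (supnorm (M%:Z, 0%:Z) <= \max_(z <- s) supnorm z)%N.
  by apply: leq_bigmax_seq => //; apply: (sq M); rewrite normM.
by rewrite normM ltnn.
Qed.

End Square.
(** * The odometer of a square pyramid *)

(** The binomial is [(m - k + 1)(m - k) / 2]; the truncated subtraction makes it vanish
    for [k >= m]. *)
Definition pyramid (m k : nat) : nat := 'C((m - k).+1, 2).

Lemma pyramid_step m k : pyramid m k = (pyramid m k.+1 + (m - k))%N.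
Proof.
rewrite /pyramid; have [mk|km] := leqP m k.
  have -> : (m - k = 0)%N by lia.
  by have -> : (m - k.+1 = 0)%N by lia.
have -> : (m - k = (m - k.+1).+1)%N by lia.
by rewrite [in LHS]binS bin1.
Qed.

Lemma pyramid_double m k : (2 * pyramid m k = (m - k).+1 * (m - k))%N.
Proof. by rewrite /pyramid -mul_bin_diag bin1. Qed.

(** At a cell with two coordinates of different absolute values, two
    neighbours have the same norm and the two others have the norms before and
    after, so the Laplacian is a second difference of [pyramid m]; on the
    diagonals all neighbours have the same or the next norm, where the
    nonincreasing [pyramid m] takes no larger values. *)
Lemma laplacian_pyramid_le1 m z : z != (0, 0) ->
  laplacian (fun v => (pyramid m (supnorm v))%:Z) z <= 1.
Proof.
rewrite -supnorm_eq0; case: z => x y z0.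
have [k kE] : exists k, supnorm (x, y) = k.+1 by exists (supnorm (x, y)).-1; lia.
have low := pyramid_step m k; have high := pyramid_step m k.+1.
have [xy|xy|xy] := ltngtP `|x|%N `|y|%N.
- rewrite laplacianE kE.
  have -> : supnorm (x + 1, y) = k.+1 by rewrite /supnorm /= in kE *; lia.
  have -> : supnorm (x - 1, y) = k.+1 by rewrite /supnorm /= in kE *; lia.
  have [[-> ->]|[-> ->]] :
      supnorm (x, y + 1) = k.+2 /\ supnorm (x, y - 1) = k \/
      supnorm (x, y + 1) = k /\ supnorm (x, y - 1) = k.+2
    by rewrite /supnorm /= in kE *; lia.
  + lia.
  + lia.
- rewrite laplacianE kE.
  have -> : supnorm (x, y + 1) = k.+1 by rewrite /supnorm /= in kE *; lia.
  have -> : supnorm (x, y - 1) = k.+1 by rewrite /supnorm /= in kE *; lia.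
  have [[-> ->]|[-> ->]] :
      supnorm (x + 1, y) = k.+2 /\ supnorm (x - 1, y) = k \/
      supnorm (x + 1, y) = k /\ supnorm (x - 1, y) = k.+2
    by rewrite /supnorm /= in kE *; lia.
  + lia.
  + lia.
- apply: le_trans (le_laplacian (g := fun=> (pyramid m k.+1)%:Z) _ _) _ => /=.
  + move=> v vz; have [->|->] : supnorm v = k.+1 \/ supnorm v = k.+2.
      move: vz; rewrite /neighbours !inE /=.
      by rewrite /supnorm /= in kE *; do ![case/orP]=> /eqP-> /=; lia.
    * by [].
    * lia.
  + by rewrite kE.
  + rewrite laplacianE; lia.
Qed.

(** * Gluing *)

Section Glue.

Variables (f g : cell -> int) (j k : nat).
Hypotheses (jk : (j < k)%N)
  (le_fg : forall z, supnorm z = j -> f z <= g z)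
  (le_gf : forall z, supnorm z = k -> g z <= f z).

Definition glue (z : cell) : int :=
  if (supnorm z <= j)%N then f z
  else if (supnorm z < k)%N then Num.min (f z) (g z) else g z.

Lemma glue_le_inner z : (supnorm z <= k)%N -> glue z <= f z.
Proof.
rewrite /glue => zk; case: (leqP (supnorm z) j) => // _.
case: (ltnP (supnorm z) k) => kz; first by rewrite ge_min lexx.
by apply: le_gf; lia.
Qed.

Lemma glue_le_outer z : (j <= supnorm z)%N -> glue z <= g z.
Proof.
rewrite /glue => jz; case: (leqP (supnorm z) j) => zj; first by apply: le_fg; lia.
by case: (ltnP (supnorm z) k) => // _; rewrite ge_min lexx orbT.
Qed.

(** Each value of [glue] is one of [f] or [g], and [glue] is below that function at
    the neighbouring cells, so its Laplacian there is no larger. *)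
Lemma laplacian_glue_le (b : cell -> int) :
  (forall z, (supnorm z < k)%N -> laplacian f z <= b z) ->
  (forall z, (j < supnorm z)%N -> laplacian g z <= b z) ->
  forall z, laplacian glue z <= b z.
Proof.
move=> fb gb z.
have inner : (supnorm z < k)%N -> glue z = f z -> laplacian glue z <= b z.
  move=> zk zf; apply: le_trans (fb z zk); apply: le_laplacian zf => v vz.
  by apply: glue_le_inner; have [] := supnorm_neighbour vz; lia.
have outer : (j < supnorm z)%N -> glue z = g z -> laplacian glue z <= b z.
  move=> jz zg; apply: le_trans (gb z jz); apply: le_laplacian zg => v vz.
  by apply: glue_le_outer; have [] := supnorm_neighbour vz; lia.
have [zj|jz] := leqP (supnorm z) j.
  by apply: inner; [lia | rewrite /glue zj].
have [zk|kz] := ltnP (supnorm z) k; last first.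
  by apply: outer => //; rewrite /glue !ifN // -?ltnNge -?leqNgt.
have gz : glue z = Num.min (f z) (g z) by rewrite /glue zk leqNgt jz.
by case: (leP (f z) (g z)) gz => _ gz; [apply: inner | apply: outer].
Qed.

End Glue.

(** * A logarithmic spike *)

Section Spike.

Variable R : realType.
Implicit Types (z : cell) (n j : nat).

Definition sqnorm z : R := z.1%:~R ^+ 2 + z.2%:~R ^+ 2.

Lemma sqnorm_itv z :
  (supnorm z)%:R ^+ 2 <= sqnorm z <= 2 * (supnorm z)%:R ^+ 2.
Proof.
case: z => x y; rewrite /supnorm /sqnorm /=.
have E (u : int) : u%:~R ^+ 2 = (`|u|%N ^ 2)%:R :> R.
  by rewrite natrX natr_absz intr_norm real_normK ?num_real.
rewrite !E -natrX -natrD -[2]/(2%:R) -natrM !ler_nat.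
by move: `|x|%N `|y|%N => a b; nia.
Qed.

Definition loglevel z : R := ln (sqnorm z + 2^-1).

(** With [P = x^2 + y^2 + 1/2], the product of the values of the same expression at the
    four neighbours is [P^4 + 4 P + 3 + 16 x^2 y^2], which exceeds [P^4]. *)
Lemma laplacian_loglevel_ge0 z : 0 <= laplacian loglevel z.
Proof.
case: z => x y; rewrite laplacianE /loglevel /sqnorm /= !intrD !intrN.
set a : R := x%:~R; set b : R := y%:~R.
have pos (u v : R) : 0 < u ^+ 2 + v ^+ 2 + 2^-1.
  by rewrite ltr_pwDr ?invr_gt0 // addr_ge0 // sqr_ge0.
rewrite subr_ge0 -!lnM ?posrE ?mulr_gt0 //.
rewrite mulr_natl -lnXn // ler_ln ?posrE ?exprn_gt0 ?mulr_gt0 //.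
set P := a ^+ 2 + b ^+ 2 + 2^-1.
rewrite -subr_ge0 (_ : _ - _ = 4 * P + 3 + 16 * (a * b) ^+ 2).
  by have := pos a b; have := sqr_ge0 (a * b); rewrite -/P; lra.
by rewrite /P; field.
Qed.

Lemma laplacian_loglevel_origin : laplacian loglevel (0, 0) = 4 * ln 3.
Proof.
rewrite laplacianE /loglevel /sqnorm /= !(add0r, addr0, sub0r, subr0).
rewrite !intrN !sqrrN expr0n expr1n !(add0r, addr0).
rewrite (_ : 1 + 2^-1 = 3 * 2^-1 :> R); last by field.
by rewrite lnM ?posrE ?invr_gt0 //; ring.
Qed.

Lemma laplacian_sqnorm z : laplacian sqnorm z = 4.
Proof. by case: z => x y; rewrite laplacianE /sqnorm /= !intrD !intrN; ring. Qed.

(** The ceiling adds less than one at each of the four neighbours and lowers nothing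
    at the cell itself. *)
Lemma laplacian_ceil_lt (f : cell -> R) z :
  (laplacian (fun v => Num.ceil (f v)) z)%:~R < laplacian f z + 4.
Proof.
case: z => x y; rewrite !laplacianE !intrD intrN intrM.
have up v : (Num.ceil (f v))%:~R < f v + 1 by have := ceilB1_lt (f v); rewrite intrB; lra.
have dn v : f v <= (Num.ceil (f v))%:~R by apply: ceil_ge.
have := up (x + 1, y); have := up (x - 1, y); have := up (x, y + 1).
by have := up (x, y - 1); have := dn (x, y); lra.
Qed.

(** The height for which the spike lies above the pyramid on the frame of norm
    [3 j], where [sqnorm] is at most [18 j ^ 2]. *)
Definition spike_height n j : R :=
  (pyramid (9 * j) (3 * j))%:R + 9 * j%:R ^+ 2
    + n%:R / (4 * ln 3) * ln (18 * j%:R ^+ 2 + 2^-1).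

Definition spike n j z : R :=
  spike_height n j - n%:R / (4 * ln 3) * loglevel z - sqnorm z / 2.

Lemma ln3_gt0 : 0 < ln 3 :> R. Proof. by rewrite ln_gt0 // ltr1n. Qed.

Lemma laplacian_spike n j z :
  laplacian (spike n j) z = - (n%:R / (4 * ln 3)) * laplacian loglevel z - 2.
Proof.
have := laplacian_sqnorm z.
by case: z => x y; rewrite !laplacianE /spike; move: (n%:R / _) => q; lra.
Qed.

Lemma laplacian_ceil_spike n j z :
  laplacian (fun v => Num.ceil (spike n j v)) z <= 3 - pile n z.
Proof.
have := laplacian_ceil_lt (spike n j) z; rewrite laplacian_spike.
move: (laplacian (fun v => Num.ceil (spike n j v)) z) => d h.
rewrite -ltzD1 -(ltr_int R); apply: lt_le_trans h _.
rewrite /pile; case: eqP => [->|_].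
  rewrite laplacian_loglevel_origin intrD intrB -pmulrn.
  rewrite (_ : _ * (4 * ln 3) = - n%:R); last by field; rewrite gt_eqF ?ln3_gt0.
  lra.
have : 0 <= n%:R / (4 * ln 3) * laplacian loglevel z.
  by rewrite !mulr_ge0 ?invr_ge0 ?laplacian_loglevel_ge0 // ltW ?mulr_gt0 ?ln3_gt0.
lra.
Qed.

Lemma spike_ge n j z : (supnorm z <= 3 * j)%N ->
  (pyramid (9 * j) (3 * j))%:R <= spike n j z.
Proof.
move=> zj; have /andP[sq_ge sq_le] := sqnorm_itv z.
have zj2 : (supnorm z)%:R ^+ 2 <= 9 * j%:R ^+ 2 :> R.
  by rewrite -!natrX -[9]/(9%:R) -natrM ler_nat; nia.
have sq0 : 0 <= sqnorm z by apply: le_trans sq_ge; apply: sqr_ge0.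
have log_le : loglevel z <= ln (18 * j%:R ^+ 2 + 2^-1).
  rewrite ler_ln ?posrE; lra.
have : 0 <= n%:R / (4 * ln 3) * (ln (18 * j%:R ^+ 2 + 2^-1) - loglevel z).
  by rewrite !mulr_ge0 ?invr_ge0 ?subr_ge0 // ltW ?mulr_gt0 ?ln3_gt0.
rewrite /spike /spike_height mulrBr; lra.
Qed.

(** The hypothesis on [n] is the exact balance of the two sides once the logarithms are
    compared: [18 j ^ 2 + 3 j + 9 j ^ 2 - j ^ 2 / 2 + 3 n / 4 <= 32 j ^ 2 + 4 j],
    up to the linear terms. *)
Lemma spike_le n j z : (3 * n <= 22 * j ^ 2)%N -> supnorm z = j ->
  spike n j z <= (pyramid (9 * j) j)%:R.
Proof.
move=> nj zj; have /andP[sq_ge _] := sqnorm_itv z; rewrite zj in sq_ge.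
have {}nj : 3 * n%:R <= 22 * j%:R ^+ 2 :> R.
  by rewrite -natrX -[3]/(3%:R) -[22]/(22%:R) -!natrM ler_nat.
have j2 : 0 <= j%:R ^+ 2 :> R by apply: sqr_ge0.
(* The ratio of the arguments of the logarithms is at most [18 <= 3 ^ 3]. *)
have log_le : ln (18 * j%:R ^+ 2 + 2^-1) <= 3 * ln 3 + loglevel z.
  rewrite [3 * _]mulr_natl -lnXn // -lnM ?posrE ?exprn_gt0 //; last by lra.
  rewrite ler_ln ?posrE ?mulr_gt0 ?exprn_gt0 //; lra.
have : n%:R / (4 * ln 3) * (ln (18 * j%:R ^+ 2 + 2^-1) - loglevel z) <= 3 / 4 * n%:R.
  rewrite [leRHS](_ : _ = n%:R / (4 * ln 3) * (3 * ln 3)); last first.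
    by field; rewrite gt_eqF ?ln3_gt0.
  rewrite ler_wpM2l ?mulr_ge0 ?invr_ge0 //; last by lra.
  by rewrite ltW ?mulr_gt0 ?ln3_gt0.
have : (pyramid (9 * j) j)%:R - (pyramid (9 * j) (3 * j))%:R = 14 * j%:R ^+ 2 + j%:R :> R.
  have <- : (14 * j ^ 2 + j)%:R = 14 * j%:R ^+ 2 + j%:R :> R.
    by rewrite natrD natrM natrX.
  have e1 := pyramid_double (9 * j) j; have e2 := pyramid_double (9 * j) (3 * j).
  rewrite -natrB; first by congr _%:R; nia.
  by nia.
have := ler0n R j.
rewrite /spike /spike_height mulrBr; lra.
Qed.

End Spike.


Lemma exists_small_cluster (R : realType) n j : (0 < j)%N -> (3 * n <= 22 * j ^ 2)%N ->
  exists2 s, stabilises (pile n) s & forall z, z \in s -> (supnorm z < 9 * j)%N.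
Proof.
move=> j_gt0 nj.
pose f z := Num.ceil (spike R n j z).
pose g z := (pyramid (9 * j) (supnorm z))%:Z.
have jj : (j < 3 * j)%N by lia.
have fg z : supnorm z = j -> f z <= g z.
  by move=> zj; rewrite ceil_le_int -pmulrn /g zj; apply: spike_le.
have gf3 z : (supnorm z <= 3 * j)%N -> (pyramid (9 * j) (3 * j))%:Z <= f z.
  move=> zj; rewrite -(ler_int R) -pmulrn.
  by apply: le_trans (ceil_ge _); apply: spike_ge.
have gf z : supnorm z = (3 * j)%N -> g z <= f z.
  by move=> zj; rewrite /g zj; apply: gf3; rewrite zj.
apply: (@odometer_bound _ (glue f g j (3 * j))) => z.
- have g_ge0 : 0 <= g z by [].
  rewrite /glue; case: (leqP (supnorm z) j) => zj.
    by apply: le_trans (gf3 z _) => //; lia.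
  case: (ltnP (supnorm z) (3 * j)) => // zk; rewrite le_min g_ge0 andbT.
  by apply: le_trans (gf3 z _) => //; lia.
- move=> zj; rewrite /glue !ifN -?ltnNge -?leqNgt; [|lia|lia].
  by rewrite /g /pyramid (_ : (9 * j - _ = 0)%N); last by lia.
- apply: (laplacian_glue_le jj fg gf (b := fun z => 3 - pile n z)) => {}z zj.
    exact: laplacian_ceil_spike.
  have z0 : z != (0, 0) by rewrite -supnorm_eq0; lia.
  by rewrite /pile (negbTE z0); apply: laplacian_pyramid_le1.
Qed.
(** * The radius *)

Lemma cell_radius_square (R : realType) (k : nat) :
  cell_radius R (centred_square k.+1%:Z) = (k.+1%:Z%:~R : R)%:E.
Proof.
have mem z : centred_square k.+1%:Z z <-> (supnorm z <= k)%N.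
  by rewrite /centred_square /= cell_normE; lia.
rewrite /cell_radius; case: asboolP => [sq0|_].
  by have /mem : (supnorm (0%R, 0%R) <= k)%N by []; rewrite sq0.
suff -> : ereal_sup [set ((cell_norm z)%:~R : R)%:E | z in centred_square k.+1%:Z] = (k%:R)%:E.
  by rewrite -EFinD -pmulrn natr1.
apply/eqP; rewrite eq_le; apply/andP; split.
  apply: ge_ereal_sup => _ [z /mem zk <-].
  by rewrite lee_fin cell_normE -pmulrn ler_nat.
apply: ereal_sup_ubound; have kE : supnorm (k%:Z, 0%:Z) = k by rewrite /supnorm maxn0.
by exists (k%:Z, 0); [apply/mem; rewrite kE | rewrite cell_normE kE -pmulrn].
Qed.

Lemma pile_square (R : realType) (n : nat) : (4 <= n)%N ->
  exists r : int, [/\ stabilisation_terminates (pile n), 1 <= r,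
    toppled_cluster (pile n) = centred_square r,
    cell_radius R (toppled_cluster (pile n)) = (r%:~R : R)%:E
    & r%:~R <= 4 * Num.sqrt (n%:R : R) + 9].
Proof.
move=> n_ge4; pose t : R := 4 / 9 * Num.sqrt n%:R.
have t_ge0 : 0 <= t by rewrite mulr_ge0 ?sqrtr_ge0.
(* Any [j] with [3 n <= 22 j ^ 2] bounds the radius by [9 j]; this one makes the
   bound [4 sqrt n + 9]. *)
pose j := (Num.truncn t).+1.
have tj : t < j%:R by apply: truncnS_gt.
have jt : j%:R <= t + 1 by rewrite -natr1 lerD2r truncn_le.
have nj : (3 * n <= 22 * j ^ 2)%N.
  rewrite -(ler_nat R) natrM (natrM _ 22) natrX.
  have : t ^+ 2 <= j%:R ^+ 2 by rewrite lerXn2r ?nnegrE // ltW.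
  have : 0 <= n%:R :> R by [].
  by rewrite /t exprMn sqr_sqrtr //; lra.
have [s st s_lt] := exists_small_cluster R (ltn0Sn _) nj.
have [k sk] := toppled_square n_ge4 st.
have TE : toppled_cluster (pile n) = centred_square k.+1%:Z.
  rewrite (toppled_clusterE st); apply/seteqP.
  by split=> z; rewrite /centred_square /= sk cell_normE; lia.
exists k.+1%:Z; split => //; first by exists s.
  by rewrite TE cell_radius_square.
have kj : (k < 9 * j)%N.
  have kE : supnorm (k%:Z, 0%:Z) = k by rewrite /supnorm maxn0.
  by rewrite -kE; apply: s_lt; rewrite sk kE.
have : k.+1%:R <= 9 * j%:R :> R by rewrite -natrM ler_nat.
by rewrite -pmulrn /t in jt *; lra.
Qed.

Lemma cvg_inv_sqrtn (R : realType) : (Num.sqrt (n%:R : R))^-1 @[n --> \oo] --> (0 : R).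
Proof.
apply/cvgrPdist_lt => e e0; near=> n.
have ne : e^-1 ^+ 2 < n%:R by near: n; exact: nbhs_infty_gtr.
have n0 : 0 < n%:R :> R by apply: le_lt_trans ne; apply: sqr_ge0.
rewrite sub0r normrN ger0_norm ?invr_ge0 ?sqrtr_ge0 //.
rewrite invf_plt ?posrE ?sqrtr_gt0 // -(ger0_norm (_ : 0 <= e^-1)) ?invr_ge0 ?ltW //.
by rewrite -sqrtr_sqr ltr_sqrt.
Unshelve. all: by end_near. Qed.

Theorem theorem2 (R : realType) :
  exists r : nat -> int,
    (forall n : nat, (4 <= n)%N ->
      [/\ stabilisation_terminates (pile n),
          1 <= r n,
          toppled_cluster (pile n) = centred_square (r n)
        & cell_radius R (toppled_cluster (pile n)) = ((r n)%:~R : R)%:E]) /\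
    exists eps : nat -> R,
      eps n @[n --> \oo] --> (0 : R) /\
      forall n : nat, (4 <= n)%N ->
        (r n)%:~R <= 4 * (1 + eps n) * Num.sqrt (n%:R : R).
Proof.
have /choice[r rP] : forall n : nat, exists r : int, (4 <= n)%N ->
    [/\ stabilisation_terminates (pile n), 1 <= r,
      toppled_cluster (pile n) = centred_square r,
      cell_radius R (toppled_cluster (pile n)) = (r%:~R : R)%:E
      & r%:~R <= 4 * Num.sqrt (n%:R : R) + 9].
  move=> n; have [/pile_square-/(_ R)[r]|_] := leqP 4 n; last by exists 0.
  by exists r.
exists r; split=> [n /rP[] //|].
exists (fun n => 9 / 4 * (Num.sqrt n%:R)^-1); split.
  by rewrite -[0](mulr0 (9 / 4)); apply: cvgMr; apply: cvg_inv_sqrtn.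
move=> n n_ge4; have [_ _ _ _ /le_trans] := rP n n_ge4; apply.
have : 0 < Num.sqrt n%:R :> R by rewrite sqrtr_gt0 ltr0n; lia.
move=> /lt0r_neq0 s0; rewrite le_eqVlt; apply/orP; left; apply/eqP.
by field.
Qed.
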